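(* Let $E,J,R\in\mathbb{C}^{n,n}$ and $B\in\mathbb{C}^{n,m}$ with $E=E^H\ge 0$, $R=R^H\ge 0$, $J=-J^H$ and $B$ of full column rank (the coefficients of a port-Hamiltonian descriptor system $E\dot x=(J-R)x+Bu$, $y=B^Hx$). There exists a matrix $K\in\mathbb{C}^{m,m}$ such that the pair $(E+BKB^H,\;J-R)$ is regular and of index at most one, and $E+BKB^H\ge 0$, if and only if both $$\operatorname{rank}\begin{bmatrix}E & J-R & B\end{bmatrix}=n$$ and $$\operatorname{rank}\Big(\mathcal{T}_\infty^H(B)\,E\,\mathcal{S}_\infty\big(\mathcal{T}_\infty^H(\begin{bmatrix}E & B\end{bmatrix})(J-R)\big)\Big)=\operatorname{rank}\begin{bmatrix}E & B\end{bmatrix}-\operatorname{rank}(B)$$ hold.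
   Context: $\mathbb{C}^{p,q}$ denotes the complex $p\times q$ matrices. $M\ge 0$ ($M>0$) means that $M$ is Hermitian positive semidefinite (positive definite). A pair $(E,A)$ of square matrices (identified with the pencil $\lambda E-A$) is regular if $\det(\lambda_0E-A)\ne 0$ for some $\lambda_0\in\mathbb{C}$. The index of a regular pair is the size of the largest Jordan block associated with the eigenvalue $\infty$ in its Kronecker (Weierstrass) canonical form, and is $0$ if $E$ is invertible. $\mathcal{S}_\infty(M)$ denotes a full column rank matrix whose columns span the right nullspace of $M$; $\mathcal{T}_\infty(M)$ denotes a full column rank matrix whose columns span the left nullspace of $M$ (so $\mathcal{T}_\infty(M)^HM=0$), and $\mathcal{T}_\infty^H(M)=(\mathcal{T}_\infty(M))^H$. Trivial nullspaces give empty matrices, which have rank $0$. *)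

(* Defs.v *)
(* The definitions are over a [numClosedFieldType]; the complex numbers are the
   instance [R[i]] with [R : realType]. *)
From HB Require Import structures.
From mathcomp Require Import all_boot all_order all_algebra.
From mathcomp Require Import reals complex.

Set Implicit Arguments.
Unset Strict Implicit.
Unset Printing Implicit Defensive.

Import Order.TTheory GRing.Theory Num.Theory.
Local Open Scope ring_scope.
Local Open Scope sesquilinear_scope.

(* The order of a [numClosedFieldType] is partial: [0 <= z] means that [z] is
   real and nonnegative. *)
Definition psdmx (C : numClosedFieldType) (n : nat) (M : 'M[C]_n) : Prop :=
  M \is hermsymmx /\ forall x : 'cV[C]_n, 0 <= (x^t* *m M *m x) 0 0.

Definition regular_pair (C : numClosedFieldType) (n : nat) (E A : 'M[C]_n) :
  Prop := exists l : C, \det (l *: E - A) != 0.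

Definition jordan_block (C : numClosedFieldType) (a : C) (k : nat) : 'M[C]_k :=
  \matrix_(i, j) (a *+ (i == j) + (j == i.+1 :> nat)%:R).

(* A Jordan canonical form is given by its list of blocks (eigenvalue, size). *)
Fixpoint jordan_dim (C : Type) (s : seq (C * nat)) : nat :=
  if s is b :: s' then (b.2 + jordan_dim s')%N else 0%N.

Fixpoint jordan_mx (C : numClosedFieldType) (s : seq (C * nat)) :
    'M[C]_(jordan_dim s) :=
  if s is b :: s' return 'M[C]_(jordan_dim s)
  then block_mx (jordan_block b.1 b.2) 0 0 (jordan_mx s')
  else 0.

Definition nilblocks (C : numClosedFieldType) (inf : seq nat) :
  seq (C * nat) := [seq (0, k) | k <- inf].

(* [(E, A)] is strongly equivalent to [(diag(I, N), diag(F, I))], where [F] has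
   the Jordan blocks [fin] and the nilpotent matrix [N] has Jordan blocks whose
   sizes are listed in [inf] (the blocks of the eigenvalue infinity). *)
Definition weierstrass_form (C : numClosedFieldType) (n : nat) (E A : 'M[C]_n)
    (fin : seq (C * nat)) (inf : seq nat) : Prop :=
  exists (e : (jordan_dim fin + jordan_dim (nilblocks C inf))%N = n)
         (P Q : 'M[C]_n),
    [/\ P \in unitmx, Q \in unitmx,
        P *m E *m Q =
          castmx (e, e) (block_mx 1%:M 0 0 (jordan_mx (nilblocks C inf)))
      & P *m A *m Q = castmx (e, e) (block_mx (jordan_mx fin) 0 0 1%:M)].

(* The maximum of an empty list is 0, which is the case of an invertible [E];
   blocks of size 0 are empty and do not change the maximum. *)
Definition pair_index (C : numClosedFieldType) (n : nat) (E A : 'M[C]_n)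
    (nu : nat) : Prop :=
  exists (fin : seq (C * nat)) (inf : seq nat),
    weierstrass_form E A fin inf /\ nu = (\max_(k <- inf) k)%N.

Definition right_null_basis (C : numClosedFieldType) (p q k : nat)
    (M : 'M[C]_(p, q)) (S : 'M[C]_(q, k)) : Prop :=
  \rank S = k /\
  forall x : 'cV[C]_q, M *m x = 0 <-> exists y : 'cV[C]_k, x = S *m y.

Definition left_null_basis (C : numClosedFieldType) (p q k : nat)
    (M : 'M[C]_(p, q)) (T : 'M[C]_(p, k)) : Prop :=
  \rank T = k /\
  forall x : 'cV[C]_p, x^t* *m M = 0 <-> exists y : 'cV[C]_k, x = T *m y.

Lemma right_null_basis_exists (C : numClosedFieldType) (p q : nat)
    (M : 'M[C]_(p, q)) :
  exists (k : nat) (S : 'M[C]_(q, k)), right_null_basis M S.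
Proof.
exists (\rank (kermx M^T)), (row_base (kermx M^T))^T; split.
  by rewrite mxrank_tr eq_row_base.
move=> x; have -> : (M *m x = 0) <-> (x^T <= kermx M^T)%MS.
  split=> [h|/sub_kermxP h].
    by apply/sub_kermxP; rewrite -trmx_mul h trmx0.
  by rewrite -[M *m x]trmxK trmx_mul h trmx0.
rewrite -(eq_row_base (kermx M^T)); split=> [/submxP[D h]|[y ->]].
  by exists D^T; rewrite -trmx_mul -h trmxK.
by rewrite trmx_mul trmxK submxMl.
Qed.

Lemma left_null_basis_exists (C : numClosedFieldType) (p q : nat)
    (M : 'M[C]_(p, q)) :
  exists (k : nat) (T : 'M[C]_(p, k)), left_null_basis M T.
Proof.
have [k [S [rS hS]]] := right_null_basis_exists (M^t*).
exists k, S; split=> // x; rewrite -hS.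
have tc m n o (A : 'M[C]_(m, n)) (B : 'M_(n, o)) :
  (A *m B)^t* = B^t* *m A^t* by rewrite trmx_mul map_mxM.
split=> h; last first.
  by rewrite -[LHS]trmxCK tc trmxCK h trmx0 map_mx0.
by rewrite -[LHS]trmxCK tc trmxCK h trmx0 map_mx0.
Qed.

(* Main.v *)
(** Write [A = J - Rd], [N0] for the common kernel of [E] and [B^t*], and [W] for
    the space of [w] with [E w] in the image of [B].  Both rank conditions
    together say that no nonzero [u] in [N0] satisfies [u^t* A w = 0] for all
    [w] in [W].  A pencil [(M, A)] with [M] Hermitian is regular of index at
    most one iff the form [y^t* A x] is nondegenerate on [ker M].  If
    [M = E + B K B^t*], then [N0] lies in [ker M], which lies in [W], so the
    conditions are necessary.
    Conversely, some [K0] makes [M0 = E + B K0 B^t*] positive semidefinite with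
    kernel [W]; adding [B P B^t*] for an orthogonal projector [P] then realises
    the kernel [V = N0 + Pi A D0], where [D0] is the radical of the form on [N0]
    and [Pi] projects orthogonally onto [W].  By dissipativity [Rd D0 = 0], so
    [A] is skew-Hermitian on [D0] and pairs [D0] with [Pi A D0] by
    [- |Pi A x|^2]; hence the form is nondegenerate on [V]. *)
Require Import Defs.
From HB Require Import structures.
From mathcomp Require Import all_boot all_order all_algebra.
From mathcomp Require Import reals complex.

Set Implicit Arguments.
Unset Strict Implicit.
Unset Printing Implicit Defensive.

Import Order.TTheory GRing.Theory Num.Theory.
Local Open Scope ring_scope.
Local Open Scope sesquilinear_scope.

(** * Jordan canonical form *)

Lemma row_free_inj (F : fieldType) (m n : nat) (A : 'M[F]_(m, n)) :
  (forall u : 'rV_m, u *m A = 0 -> u = 0) -> row_free A.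
Proof.
move=> h; rewrite -kermx_eq0; apply/eqP/row_matrixP => i.
by rewrite row0; apply: h; rewrite -row_mul mulmx_ker row0.
Qed.

(** The left kernel of [Phi] is stable under [A] because the column space of [Phi] is, and
    invertibility of [V *m Phi] makes it a complement of the row space of [V]. *)
Lemma split_invariant (F : fieldType) (n k : nat) (A : 'M[F]_n)
    (V : 'M_(k, n)) (Phi : 'M_(n, k)) (L : 'M_k) :
    V *m A = L *m V -> (Phi^T *m A^T <= Phi^T)%MS -> V *m Phi \in unitmx ->
  exists (l : nat) (A' : 'M_l) (P : 'M_(k + l, n)) (Q : 'M_(n, k + l)),
    [/\ P *m Q = 1%:M, Q *m P = 1%:M & P *m A *m Q = block_mx L 0 0 A'].
Proof.
move=> VA /submxP[M /(congr1 trmx)]; rewrite !trmx_mul !trmxK => APhi uVPhi.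
pose U := row_base (kermx Phi); pose P := col_mx V U.
have UPhi : U *m Phi = 0 by apply/sub_kermxP; rewrite eq_row_base.
have /submxP[A' UA] : (U *m A <= U)%MS.
  by rewrite eq_row_base; apply/sub_kermxP; rewrite -mulmxA APhi mulmxA UPhi mul0mx.
have frP : row_free P.
  apply: row_free_inj => u; rewrite -[u]hsubmxK mul_row_col => h.
  have uV : lsubmx u = 0.
    move: (congr1 (mulmx^~ Phi) h); rewrite mulmxDl -mulmxA -[_ *m U *m Phi]mulmxA UPhi mulmx0 addr0.
    by rewrite mul0mx => /(congr1 (mulmx^~ (invmx (V *m Phi)))); rewrite mulmxK // mul0mx.
  move: h; rewrite uV mul0mx add0r => /eqP; rewrite mulmx_free_eq0 ?row_base_free //.
  by move/eqP ->; rewrite row_mx0.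
have rPhi : \rank Phi = k.
  apply/eqP; rewrite eqn_leq rank_leq_col -{1}(mxrank_unit uVPhi).
  exact: mxrankM_maxr.
have fuP : row_full P.
  by rewrite /row_full (eqP frP) mxrank_ker rPhi subnKC // -rPhi rank_leq_row.
exists _, A', P, (pinvmx P); split; [exact: mulmxVp | exact: mulVpmx|].
have -> : P *m A = block_mx L 0 0 A' *m P.
  by rewrite mul_col_mx VA UA mul_block_col !mul0mx addr0 add0r.
by rewrite -mulmxA mulmxVp // mulmx1.
Qed.

(** The hypothesis [V k = 0] makes the formula uniform: the last row of the block has no
    superdiagonal entry. *)
Lemma jordan_block_mulE (C : numClosedFieldType) (a : C) (k n : nat)
    (V : nat -> 'rV[C]_n) : V k = 0 ->
  jordan_block a k *m (\matrix_(i < k) V i) =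
  \matrix_(i < k) (a *: V i + V i.+1).
Proof.
move=> Vk; apply/row_matrixP => i; rewrite row_mul rowK; apply/rowP => j.
rewrite !mxE (eq_bigr (fun l : 'I_k => (if l == i then a * V l 0 j else 0)
    + (if l == i.+1 :> nat then V l 0 j else 0))); last first.
  by move=> l _; rewrite !mxE mulrDl eq_sym !mulrnAl mul1r !mulrb.
rewrite big_split /=; congr (_ + _).
  by rewrite -big_mkcond big_pred1_eq.
have [lt_ik|le_ki] := ltnP i.+1 k.
  by rewrite -big_mkcond (big_pred1 (Ordinal lt_ik)).
rewrite big1 => [|l _]; last by rewrite ltn_eqF // (leq_trans (ltn_ord l)).
suff -> : i.+1 = k by rewrite Vk mxE.
by apply/eqP; rewrite eqn_leq ltn_ord.
Qed.

(* For [q (X - a)^k] the minimal polynomial and [N = A - a], the cyclic spaces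
   generated by a row and a column of [q(A)] are dual to each other when
   [q(A)^2 N^(k-1)] is nonzero at the corresponding entry. *)
Lemma jordan_split (C : numClosedFieldType) (n : nat) (A : 'M[C]_n) :
  (0 < n)%N ->
  exists (a : C) (k l : nat) (A' : 'M_l) (P : 'M_(k + l, n)) (Q : 'M_(n, k + l)),
    [/\ (0 < k)%N, P *m Q = 1%:M, Q *m P = 1%:M
      & P *m A *m Q = block_mx (jordan_block a k) 0 0 A'].
Proof.
case: n A => // n A _.
have mp0 : mxminpoly A != 0 by rewrite monic_neq0 ?mxminpoly_monic.
have /closed_rootP[a ra] : size (mxminpoly A) != 1%N.
  by rewrite size_mxminpoly eqSS -lt0n mxminpoly_nonconstant.
have [k [q]] := multiplicity_XsubC (mxminpoly A) a.
rewrite mp0 /= => qa Dmp; case: k Dmp => [|k] Dmp.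
  by move: ra; rewrite Dmp mulr1 (negPf qa).
pose N := A - a%:M; pose q_A := horner_mx A q.
have NE : horner_mx A ('X - a%:P) = N by rewrite rmorphB /= horner_mx_X horner_mx_C.
have qN0 : q_A * N ^+ k.+1 = 0.
  by rewrite /q_A -NE -rmorphXn -rmorphM /= -Dmp mx_root_minpoly.
have cN j : q_A * N ^+ j = N ^+ j * q_A.
  by rewrite /q_A -NE -rmorphXn -!rmorphM /= mulrC.
have qN0' j : (k < j)%N -> q_A * N ^+ j = 0.
  by move=> lt_kj; rewrite -(subnKC lt_kj) exprD mulrA qN0 mul0r.
(* Otherwise the minimal polynomial [q (X - a)^(k+1)] would divide [q^2 (X - a)^k], and [a] would be
   a root of [q]. *)
have : q_A * N ^+ k * q_A != 0.
  rewrite /q_A -NE -rmorphXn -!rmorphM /= -dvd_mxminpoly Dmp mulrAC exprS mulrA.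
  rewrite dvdp_mul2r ?expf_neq0 ?polyXsubC_eq0 //.
  rewrite dvdp_mul2l; last by apply: contraNneq mp0 => q0; rewrite Dmp q0 mul0r.
  by rewrite dvdp_XsubCl.
  move=> /matrix0Pn[i [j nzij]].
  pose V := \matrix_(s < k.+1) row i (q_A * N ^+ s).
  (* The exponents [k - t] decrease, so [V *m Phi] is upper triangular, with the nonzero entry
     [(i, j)] of [q_A * N ^+ k * q_A] all along its diagonal. *)
  pose Phi := (\matrix_(t < k.+1) (col j (N ^+ (k - t) * q_A))^T)^T.
  have [|||l [A' [P [Q [PQ QP PAQ]]]]] := @split_invariant _ _ _ A V Phi (jordan_block a k.+1).
  - rewrite (jordan_block_mulE _ (V := fun s => row i (q_A * N ^+ s))); last first.
      by rewrite qN0 row0.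
    apply/row_matrixP => s; rewrite row_mul !rowK -row_mul.
    rewrite -[A](subrK a%:M) -/N mulmxDr mul_mx_scalar exprSr mulrA addrC.
    by rewrite linearD linearZ.
  - rewrite trmxK; apply/row_subP => t; rewrite row_mul rowK -trmx_mul.
    rewrite colE mulmxA -colE -[A](subrK a%:M) -/N mulmxDl mul_scalar_mx.
    rewrite linearD linearZ /= linearD linearZ /= addmx_sub //; last first.
      by rewrite scalemx_sub // -(rowK (fun t : 'I_k.+1 => (col j (N ^+ (k - t) * q_A))^T)) row_sub.
    rewrite [N *m _]mulrA -exprS.
    case: (posnP t) => [t0|t_gt0].
      by rewrite t0 subn0 -cN qN0 linear0 trmx0 sub0mx.
    have lt_tk : (t.-1 < k.+1)%N by rewrite (leq_trans _ (ltn_ord t)) // ltnS leq_pred.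
    have le_tk : (t <= k)%N by rewrite -ltnS.
    have -> : ((k - t).+1 = k - t.-1)%N.
      by rewrite -subSn // -[in LHS](prednK t_gt0) subSS.
    by rewrite -(rowK (fun t : 'I_k.+1 => (col j (N ^+ (k - t) * q_A))^T) (Ordinal lt_tk)) row_sub.
  - have VPhiE s t : (V *m Phi) s t = (q_A * N ^+ (s + (k - t)) * q_A) i j.
      rewrite exprD [q_A * _]mulrA -[_ * q_A]mulrA.
      rewrite !mxE; apply: eq_bigr => l _; rewrite !mxE //.
    rewrite unitmxE -det_tr det_trig.
      rewrite unitfE; apply/prodf_neq0 => s _.
      by rewrite mxE VPhiE subnKC // -ltnS.
    apply/is_trig_mxP => s t lt_st; rewrite mxE VPhiE qN0' ?mul0r ?mxE //.
    have le_sk : (s <= k)%N by rewrite -ltnS.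
    by rewrite addnBA // ltn_subRL ltn_add2r.
  by exists a, k.+1, l, A', P, Q.
Qed.

(* The change of basis matrices are rectangular so that the dimension of the
   Jordan matrix need not be cast to [n]. *)
Lemma jordan_form (C : numClosedFieldType) (n : nat) (A : 'M[C]_n) :
  exists (s : seq (C * nat)) (P : 'M_(jordan_dim s, n)) (Q : 'M_(n, jordan_dim s)),
    [/\ P *m Q = 1%:M, Q *m P = 1%:M & P *m A *m Q = jordan_mx s].
Proof.
have [r] := ubnP n; elim: r n A => // r IH [|n] A; rewrite ltnS => le_nr.
  by exists [::], 1%:M, 1%:M; rewrite !mulmx1 mul1mx; split=> //; rewrite [A]flatmx0.
have [//|a [k [l [A' [P [Q [k_gt0 PQ QP PAQ]]]]]]] := @jordan_split C _ A.
have kl : (k + l)%N = n.+1 by apply/eqP; rewrite eqn_leq (mulmx1_min PQ) (mulmx1_min QP).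
have [|s [P' [Q' [PQ' QP' PAQ']]]] := IH l A'.
  by rewrite (leq_trans _ le_nr) // -kl -add1n leq_add2r.
exists ((a, k) :: s), (block_mx 1%:M 0 0 P' *m P), (Q *m block_mx 1%:M 0 0 Q').
split.
- rewrite mulmxA -[_ *m P *m Q]mulmxA PQ mulmx1 mulmx_block.
  by rewrite !mulmx0 !mul0mx mulmx1 !addr0 add0r PQ' -scalar_mx_block.
- rewrite mulmxA -[Q *m _ *m _]mulmxA mulmx_block.
  by rewrite !mulmx0 !mul0mx mulmx1 !addr0 add0r QP' -scalar_mx_block mulmx1.
rewrite -!mulmxA [A *m (Q *m _)]mulmxA [P *m (_ *m _)]mulmxA [P *m _]mulmxA PAQ !mulmx_block.
by rewrite !mulmx0 !mul0mx !mulmx1 !mul1mx !addr0 !add0r mulmx0 mulmxA PAQ'.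
Qed.

(** * Index at most one and nondegeneracy on the kernel *)

Lemma col_inj_unitmx (F : fieldType) (k : nat) (G : 'M[F]_k) :
  (forall z : 'cV_k, G *m z = 0 -> z = 0) -> G \in unitmx.
Proof.
move=> h; rewrite -unitmx_tr -row_free_unit; apply: row_free_inj => u uG.
apply: trmx_inj; rewrite trmx0; apply: h.
by rewrite -[G]trmxK -trmx_mul uG trmx0.
Qed.

Lemma jordan_mx_nilblocks (C : numClosedFieldType) (inf : seq nat) :
  all (leq^~ 1%N) inf -> jordan_mx (nilblocks C inf) = 0.
Proof.
elim: inf => //= k inf IH /andP[k1 /IH ->].
have -> : jordan_block 0 k = 0 :> 'M[C]_k.
  apply/matrixP => i j; rewrite !mxE mul0rn add0r.
  by rewrite ltn_eqF // (leq_trans (ltn_ord j)) // (leq_trans k1).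
by rewrite block_mx0.
Qed.

(** Blocks at infinity of size at most one make the nilpotent part zero. In Weierstrass coordinates
    both kernels of [M] are then the last coordinate block, on which [A] is the identity. *)
Lemma index_le1_nondegenerate (C : numClosedFieldType) (n nu : nat)
    (M A : 'M[C]_n) (u : 'rV_n) : pair_index M A nu -> (nu <= 1)%N ->
  u *m M = 0 -> (forall w : 'cV_n, M *m w = 0 -> u *m A *m w = 0) -> u = 0.
Proof.
move=> [fin [inf [[e [P [Q [uP uQ PMQ PAQ]]]] ->]]] le1.
rewrite jordan_mx_nilblocks in PMQ; last first.
  apply/allP => k k_inf; apply: leq_trans le1.
  exact: (@leq_bigmax_seq _ _ xpredT id).
move: (jordan_mx fin) => F; move: M A u P Q uP uQ PMQ PAQ.
case: _ / e => M A u P Q uP uQ; rewrite !castmx_id => PMQ PAQ uM uA.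
pose z := u *m invmx P; have uE : u = z *m P by rewrite mulmxKV.
have z1 : lsubmx z = 0.
  have : z *m (P *m M *m Q) = 0 by rewrite !mulmxA -uE uM mul0mx.
  rewrite PMQ -{1}[z]hsubmxK mul_row_block !mulmx0 mulmx1 !addr0 -[0 in RHS]row_mx0.
  by move=> /eq_row_mx[].
have z2w (w : 'cV_(jordan_dim (nilblocks C inf))) : rsubmx z *m w = 0.
  have <- : u *m A *m (Q *m col_mx 0 w) = rsubmx z *m w.
    have -> : u *m A *m (Q *m col_mx 0 w) = z *m (P *m A *m Q) *m col_mx 0 w.
      by rewrite uE !mulmxA.
    rewrite PAQ -{1}[z]hsubmxK z1 mul_row_block mul_row_col.
    by rewrite mulmx1 !mul0mx !mulmx0 !add0r.
  apply: uA; apply: (can_inj (mulKmx uP)); rewrite !mulmxA PMQ.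
  by rewrite mul_block_col !mul0mx !mulmx0 !addr0 col_mx0.
have z2 : rsubmx z = 0.
  apply/matrixP => i j; have /matrixP/(_ i 0) := z2w (delta_mx j 0).
  by rewrite -colE !mxE.
by rewrite uE -[z]hsubmxK z1 z2 row_mx0 mul0mx.
Qed.

(** It remains to bring [F] into Jordan form: the zero block consists of [k] nilpotent blocks of
    size one, and any [l] outside the spectrum of [F] witnesses regularity. *)
Lemma index_le1_of_blocks (C : numClosedFieldType) (n r k : nat)
    (M A : 'M[C]_n) (P : 'M_(r + k, n)) (Q : 'M_(n, r + k)) (F : 'M_r) :
    (r + k)%N = n ->
    P *m M *m Q = block_mx 1%:M 0 0 0 -> P *m A *m Q = block_mx F 0 0 1%:M ->
  regular_pair M A /\ exists nu : nat, pair_index M A nu /\ (nu <= 1)%N.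
Proof.
have [inf [inf1 ek]] : exists inf : seq nat,
    all (leq^~ 1%N) inf /\ k = jordan_dim (nilblocks C inf).
  exists (nseq k 1%N); split; first by rewrite all_nseq orbT.
  by elim: k {P Q} => //= k {1}->.
move: P Q; rewrite {}ek => P Q rk PMQ PAQ.
have [fin [S [S' [SS' S'S SFS]]]] := jordan_form F.
have er : jordan_dim fin = r.
  by apply/eqP; rewrite eqn_leq (mulmx1_min SS') (mulmx1_min S'S).
have e : (jordan_dim fin + jordan_dim (nilblocks C inf))%N = n by rewrite er.
pose P1 := block_mx S 0 0 1%:M *m P; pose Q1 := Q *m block_mx S' 0 0 1%:M.
have conj X : P1 *m X *m Q1 =
    block_mx S 0 0 1%:M *m (P *m X *m Q) *m block_mx S' 0 0 1%:M.
  by rewrite !mulmxA.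
have PMQ1 : P1 *m M *m Q1 = block_mx 1%:M 0 0 (jordan_mx (nilblocks C inf)).
  rewrite conj PMQ jordan_mx_nilblocks // !mulmx_block.
  by rewrite !mulmx0 !mul0mx !mulmx1 !addr0 mul0mx SS'.
have PAQ1 : P1 *m A *m Q1 = block_mx (jordan_mx fin) 0 0 1%:M.
  rewrite conj PAQ !mulmx_block.
  by rewrite !mulmx0 !mul0mx !mulmx1 !addr0 !add0r mul0mx SFS.
move: P1 Q1 PMQ1 PAQ1 {conj} => P1 Q1 PMQ1 PAQ1.
have /closed_nonrootP[l nrl] : char_poly (jordan_mx fin) != 0.
  by rewrite monic_neq0 ?char_poly_monic.
have uF : l%:M - jordan_mx fin \in unitmx.
  rewrite unitmxE unitfE; move: nrl.
  by rewrite -eigenvalue_root_char /eigenvalue /eigenspace kermx_eq0 negbK row_free_unit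
    -opprB -scaleN1r unitmxZ ?unitrN1 // unitmxE unitfE.
have PlQ : P1 *m (l *: M - A) *m Q1 = block_mx (l%:M - jordan_mx fin) 0 0 (- 1%:M).
  rewrite mulmxBr mulmxBl -scalemxAr -scalemxAl PMQ1 PAQ1 jordan_mx_nilblocks //.
  rewrite scale_block_mx opp_block_mx add_block_mx !scaler0 !oppr0 !addr0 add0r.
  by rewrite scalemx1.
(* This determinant also yields the invertibility of [P1] and [Q1], once the elimination of [e] has
   made them square. *)
have ul : \det (P1 *m (l *: M - A) *m Q1) != 0.
  rewrite PlQ det_ublock mulf_neq0 //; first by rewrite -unitfE -unitmxE.
  by rewrite -scaleN1r detZ det1 mulr1 signr_eq0.
clear uF PlQ nrl S S' SS' S'S SFS er.
move: fin e P1 Q1 PMQ1 PAQ1 ul => fin e.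
case: _ / e M A {P Q rk PMQ PAQ} => M A P1 Q1 PMQ1 PAQ1.
rewrite !det_mulmx !mulf_eq0 !negb_or => /andP[/andP[uP ul] uQ].
split; first by exists l.
exists (\max_(i <- inf) i)%N; split.
  exists fin, inf; split=> //; exists erefl, P1, Q1.
  by rewrite !castmx_id !unitmxE !unitfE.
by apply/bigmax_leqP_seq => i i_inf _; apply: (allP inf1).
Qed.

(** If [N] spans the kernel of [M], nondegeneracy says that [G], the matrix of the form on it, is
    invertible. Then the kernels of [M] and of [N^t* *m A] are complementary, as are the row spaces
    of [N^t*] and [P1], and these splittings block-diagonalise the pencil. *)
Lemma nondegenerate_index_le1 (C : numClosedFieldType) (n : nat)
    (M A : 'M[C]_n) : M \is hermsymmx ->
    (forall x : 'cV_n, M *m x = 0 ->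
       (forall y : 'cV_n, M *m y = 0 -> y^t* *m A *m x = 0) -> x = 0) ->
  regular_pair M A /\ exists nu : nat, pair_index M A nu /\ (nu <= 1)%N.
Proof.
move=> /is_hermitianmxP; rewrite expr0 scale1r => MH nondeg.
have [k [N [rN kerN]]] := right_null_basis_exists M.
have MN : M *m N = 0.
  apply/matrixP => i j; rewrite [RHS]mxE.
  have /matrixP/(_ i 0) : M *m col j N = 0 by apply/kerN; exists (delta_mx j 0); rewrite colE.
  by rewrite colE mulmxA -colE !mxE.
have NM : N^t* *m M = 0.
  by rewrite MH -map_mxM -trmx_mul MN trmx0 map_mx0.
have N_inj z : N *m z = 0 :> 'cV_n -> z = 0.
  move=> Nz; apply: trmx_inj; rewrite trmx0; apply/eqP.
  by rewrite -(@mulmx_free_eq0 _ _ _ _ _ N^T) -?trmx_mul ?Nz ?trmx0 // /row_free mxrank_tr rN.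
pose G := N^t* *m A *m N.
have kerG (x : 'cV_n) : M *m x = 0 -> N^t* *m A *m x = 0 -> x = 0.
  move=> Mx NAx; apply: nondeg => // _ /kerN[y ->].
  by rewrite trmx_mul map_mxM -!mulmxA (mulmxA _ A) NAx mulmx0.
have uG : G \in unitmx.
  apply: col_inj_unitmx => z Gz; apply/N_inj/kerG; last by rewrite mulmxA.
  by rewrite mulmxA MN mul0mx.
pose r := \rank (kermx (A *m N)); pose P2 := invmx G *m N^t*.
have [P1 P1AN frP1] : exists2 P1 : 'M_(r, n), P1 *m (A *m N) = 0 & row_free P1.
  exists (row_base (kermx (A *m N))); last exact: row_base_free.
  by apply/sub_kermxP; rewrite eq_row_base.
have rAN : \rank (A *m N) = k.
  apply/eqP; rewrite eqn_leq rank_leq_col -{1}(mxrank_unit uG) /G -mulmxA.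
  exact: mxrankM_maxr.
have rk : (r + k)%N = n.
  by rewrite /r mxrank_ker rAN subnK // -rAN rank_leq_row.
(* The first block column [Q1] of the inverse of [X] normalises [P1 *m M *m Q1] to the identity and
   is annihilated by [N^t* *m A]. *)
pose X := col_mx (P1 *m M) (N^t* *m A).
have stack_inj (x : 'cV_n) : P1 *m x = 0 -> N^t* *m x = 0 -> x = 0.
  move=> P1x Nx; pose Y := col_mx P1 (N^t*).
  have frY : row_free Y.
    apply: row_free_inj => u; rewrite -[u]hsubmxK mul_row_col => uY.
    have u2 : rsubmx u = 0.
      move: (congr1 (mulmx^~ (A *m N)) uY); rewrite mulmxDl -mulmxA P1AN mulmx0.
      rewrite add0r mul0mx -mulmxA (mulmxA _ A) -/G.
      by move/(congr1 (mulmx^~ (invmx G))); rewrite mulmxK // mul0mx.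
    move: uY; rewrite u2 mul0mx addr0 => /eqP.
    by rewrite mulmx_free_eq0 // => /eqP ->; rewrite row_mx0.
  have fuY : row_full Y by rewrite /row_full (eqP frY) rk.
  by rewrite -[x]mul1mx -(mulVpmx fuY) -mulmxA mul_col_mx P1x Nx col_mx0 mulmx0.
have frX : row_free X.
  suff : row_free X^T by rewrite /row_free mxrank_tr => /eqP->; rewrite rk.
  apply: row_free_inj => u uX.
  have : X *m u^T = 0 by rewrite -[X]trmxK -trmx_mul uX trmx0.
  rewrite mul_col_mx -[0 in RHS]col_mx0 => /eq_col_mx[P1Mu NAu].
  apply: trmx_inj; rewrite trmx0; apply: kerG => //.
  by apply: stack_inj; rewrite mulmxA // NM mul0mx.
have := mulmxVp frX; rewrite -[pinvmx X]hsubmxK.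
set Q1 := lsubmx _; set Q2 := rsubmx _.
rewrite mul_col_row scalar_mx_block => /eq_block_mx[P1MQ1 _ NAQ1 _].
apply: (@index_le1_of_blocks _ _ _ _ M A (col_mx P1 P2) (row_mx Q1 N) (P1 *m A *m Q1) rk).
  rewrite mul_col_mx mul_col_row P1MQ1 -!mulmxA MN mulmx0 (mulmxA _ M) NM.
  by rewrite mul0mx !mulmx0.
rewrite mul_col_mx mul_col_row -!mulmxA P1AN [N^t* *m (A *m Q1)]mulmxA NAQ1 mulmx0.
by rewrite [N^t* *m _]mulmxA mulVmx.
Qed.

(** * Conjugate transposes, semidefinite matrices and orthogonal projectors *)

Lemma trmxC_mul (C : numClosedFieldType) (m n p : nat) (A : 'M[C]_(m, n))
  (B : 'M_(n, p)) : (A *m B)^t* = B^t* *m A^t*.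
Proof. by rewrite trmx_mul map_mxM. Qed.

Lemma trmxCD (C : numClosedFieldType) (m n : nat) (A B : 'M[C]_(m, n)) :
  (A + B)^t* = A^t* + B^t*.
Proof. by rewrite linearD map_mxD. Qed.

Lemma trmxCN (C : numClosedFieldType) (m n : nat) (A : 'M[C]_(m, n)) :
  (- A)^t* = - A^t*.
Proof. by rewrite linearN map_mxN. Qed.

Lemma trmxC0 (C : numClosedFieldType) (m n : nat) : (0 : 'M[C]_(m, n))^t* = 0.
Proof. by rewrite trmx0 map_mx0. Qed.

Lemma trmxC1 (C : numClosedFieldType) (n : nat) : (1%:M : 'M[C]_n)^t* = 1%:M.
Proof. by rewrite trmx1 map_mx1. Qed.

Lemma trmxC_eq0 (C : numClosedFieldType) (m n : nat) (A : 'M[C]_(m, n)) :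
  A^t* = 0 -> A = 0.
Proof. by move=> h; rewrite -[A]trmxCK h trmxC0. Qed.

Lemma hermsymmxP (C : numClosedFieldType) (n : nat) (M : 'M[C]_n) :
  reflect (M^t* = M) (M \is hermsymmx).
Proof.
apply: (iffP (is_hermitianmxP _ _ _)); rewrite expr0 scale1r; first by move=> <-.
by move=> ->.
Qed.

Lemma gram_diag_ge0 (C : numClosedFieldType) (m n : nat) (Y : 'M[C]_(m, n)) j :
  0 <= (Y^t* *m Y) j j.
Proof. by rewrite mxE sumr_ge0 // => i _; rewrite !mxE mulrC mul_conjC_ge0. Qed.

Lemma gram_eq0 (C : numClosedFieldType) (m n : nat) (Y : 'M[C]_(m, n)) :
  Y^t* *m Y = 0 -> Y = 0.
Proof.
move=> /matrixP Y0; apply/matrixP => i j; rewrite mxE.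
have /eqP := Y0 j j; rewrite !mxE psumr_eq0; last first.
  by move=> l _; rewrite !mxE mulrC mul_conjC_ge0.
by move=> /allP/(_ i (mem_index_enum _)); rewrite !mxE mulrC mul_conjC_eq0 => /eqP.
Qed.

Lemma psdmx_gram (C : numClosedFieldType) (m n : nat) (L : 'M[C]_(m, n)) :
  psdmx (L^t* *m L).
Proof.
split; first by apply/hermsymmxP; rewrite trmxC_mul trmxCK.
by move=> x; rewrite mulmxA -trmxC_mul -mulmxA gram_diag_ge0.
Qed.

Lemma psdmxD (C : numClosedFieldType) (n : nat) (M N : 'M[C]_n) :
  psdmx M -> psdmx N -> psdmx (M + N).
Proof.
move=> [/hermsymmxP hM psM] [/hermsymmxP hN psN]; split.
  by apply/hermsymmxP; rewrite trmxCD hM hN.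
by move=> x; rewrite mulmxDr mulmxDl mxE addr_ge0.
Qed.

(** By the spectral theorem, [L] can be the square root of the eigenvalue matrix times the
    diagonalising unitary. *)
Lemma psdmx_factor (C : numClosedFieldType) (n : nat) (M : 'M[C]_n) :
  psdmx M -> exists L : 'M_n, M = L^t* *m L.
Proof.
move=> [hM psM]; have /orthomx_spectralP := hermitian_normalmx hM.
have := spectral_unitarymx M; move: (spectralmx M) (spectral_diag M) => U d uU.
rewrite (invmx_unitary uU) => DM.
have d_ge0 i : 0 <= d 0 i.
  have := psM (U^t* *m delta_mx i 0).
  rewrite DM trmxC_mul trmxCK !mulmxA -[_ *m U *m U^t*]mulmxA.
  rewrite (unitarymxP uU) mulmx1 -!mulmxA (mulmxA U) (unitarymxP uU) mul1mx.
  rewrite -colE mxE (bigD1 i) //= big1 => [|j /negPf ji].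
    by rewrite !mxE !eqxx conjC1 mul1r mulr1n addr0.
  by rewrite !mxE ji andbC /= conjC0 mul0r.
exists (diag_mx (map_mx sqrtC d) *m U).
rewrite {1}DM trmxC_mul !mulmxA -[_ *m _ *m diag_mx (map_mx _ _)]mulmxA.
congr (_ *m _ *m _); rewrite tr_diag_mx map_diag_mx mulmx_diag; congr diag_mx.
apply/rowP => i; rewrite !mxE /= geC0_conj ?sqrtC_ge0 //.
by rewrite -expr2 sqrtCK.
Qed.

Lemma psdmx_null (C : numClosedFieldType) (n q : nat) (M : 'M[C]_n)
    (x : 'M_(n, q)) : psdmx M -> x^t* *m M *m x = 0 -> M *m x = 0.
Proof.
move=> /psdmx_factor[L ->]; rewrite mulmxA -trmxC_mul -mulmxA => /gram_eq0 Lx.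
by rewrite -mulmxA Lx mulmx0.
Qed.

(** [G *m X] is the orthogonal projector onto the column space of [G]; for a full rank factorisation
    [G = c *m b] it is [c (c^t* c)^-1 c^t*]. Giving [X] keeps the factor [G] visible. *)
Lemma ortho_projector (C : numClosedFieldType) (p q : nat) (G : 'M[C]_(p, q)) :
  exists X : 'M_(q, p), (G *m X)^t* = G *m X /\ G *m X *m G = G.
Proof.
have [r [c [b [-> fc fb]]]] : exists (r : nat) (c : 'M_(p, r)) (b : 'M_(r, q)),
    [/\ G = c *m b, row_full c & row_free b].
  exists (\rank G), (col_base G), (row_base G).
  by rewrite mulmx_base col_base_full row_base_free.
have uc : c^t* *m c \in unitmx.
  apply: col_inj_unitmx => z cz; rewrite -[z]mul1mx -(mulVpmx fc).
  rewrite -mulmxA [c *m z]gram_eq0 ?mulmx0 //.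
  by rewrite trmxC_mul -mulmxA (mulmxA _ c) cz mulmx0.
exists (pinvmx b *m (invmx (c^t* *m c) *m c^t*)).
have -> : c *m b *m (pinvmx b *m (invmx (c^t* *m c) *m c^t*)) =
    c *m invmx (c^t* *m c) *m c^t*.
  by rewrite -mulmxA (mulmxA b) mulmxVp // mul1mx mulmxA.
split.
  by rewrite !trmxC_mul trmxCK trmx_inv map_invmx trmxC_mul trmxCK mulmxA.
by rewrite mulmxA -[_ *m c^t* *m c]mulmxA mulmxKV.
Qed.

(** * Factorisation through null space bases *)

Lemma col_factor (F : fieldType) (n k q : nat) (S : 'M[F]_(n, k))
    (X : 'M_(n, q)) : (forall y : 'cV_q, exists z : 'cV_k, X *m y = S *m z) ->
  exists Y : 'M_(k, q), X = S *m Y.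
Proof.
move=> h; suff /submxP[Y XY] : (X^T <= S^T)%MS.
  by exists Y^T; rewrite -[X]trmxK XY trmx_mul trmxK.
apply/row_subP => j; have [z Xz] := h (delta_mx j 0).
by rewrite -tr_col colE Xz trmx_mul submxMl.
Qed.

Section NullBases.
Variables (C : numClosedFieldType) (p q k : nat) (M : 'M[C]_(p, q)).

Lemma right_null_basis_mul0 (S : 'M_(q, k)) : right_null_basis M S -> M *m S = 0.
Proof.
move=> [_ hS]; apply/matrixP => i j.
have /matrixP/(_ i 0) : M *m (S *m (delta_mx j 0 : 'cV_k)) = 0 by apply/hS; exists (delta_mx j 0).
by rewrite mulmxA -colE !mxE.
Qed.

Lemma right_null_basis_factor (r : nat) (S : 'M_(q, k)) (X : 'M_(q, r)) :
  right_null_basis M S -> M *m X = 0 -> exists Y, X = S *m Y.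
Proof.
by move=> [_ hS] MX; apply: col_factor => y; apply/hS; rewrite mulmxA MX mul0mx.
Qed.

Lemma left_null_basis_mul0 (T : 'M_(p, k)) : left_null_basis M T -> T^t* *m M = 0.
Proof.
move=> [_ hT]; apply/matrixP => i j.
have /matrixP/(_ 0 j) : (T *m (delta_mx i 0 : 'cV_k))^t* *m M = 0 by apply/hT; exists (delta_mx i 0).
by rewrite trmxC_mul trmx_delta map_delta_mx -mulmxA -rowE !mxE.
Qed.

Lemma left_null_basis_factor (r : nat) (T : 'M_(p, k)) (X : 'M_(p, r)) :
  left_null_basis M T -> X^t* *m M = 0 -> exists Y, X = T *m Y.
Proof.
move=> [_ hT] XM; apply: col_factor => y; apply/hT.
by rewrite trmxC_mul -mulmxA XM mulmx0.
Qed.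

Lemma left_null_basis_kermx (T : 'M_(p, k)) :
  left_null_basis M T -> (T^t* :=: kermx M)%MS.
Proof.
move=> hT; apply/eqmxP; apply/andP; split.
  by apply/sub_kermxP; apply: left_null_basis_mul0.
have [|Y DY] := @left_null_basis_factor _ _ ((kermx M)^t*) hT.
  by rewrite trmxCK mulmx_ker.
by rewrite -[kermx M]trmxCK DY trmxC_mul submxMl.
Qed.

End NullBases.

(** * A semidefinite feedback with the largest possible kernel *)

(** Write [E = L^t* *m L] and let [Q] project onto the image of [L *m T]. Then [L^t* *m Q *m L] is
    semidefinite and differs from [E] by a Hermitian [D] with [T^t* *m D = 0], that is, by a matrix
    of the form [B K B^t*]. *)
Lemma psdmx_extension (C : numClosedFieldType) (n m t : nat) (E : 'M[C]_n)
    (B : 'M_(n, m)) (T : 'M_(n, t)) : psdmx E -> left_null_basis B T ->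
  exists K : 'M_m, psdmx (E + B *m K *m B^t*) /\
    forall (q : nat) (w : 'M_(n, q)),
      (E + B *m K *m B^t*) *m w = 0 <-> T^t* *m E *m w = 0.
Proof.
move=> psE hT; have [L DE] := psdmx_factor psE.
have [X []] := ortho_projector (L *m T); move DQ: (_ *m X) => Q QH QG.
have QQ : Q *m Q = Q by rewrite -[in LHS]DQ mulmxA DQ QG DQ.
have DM : L^t* *m Q *m L = (Q *m L)^t* *m (Q *m L).
  by rewrite trmxC_mul QH !mulmxA -[_ *m Q *m Q]mulmxA QQ.
pose D := L^t* *m Q *m L - E.
have DH : D^t* = D.
  have /hermsymmxP EH := psE.1.
  by rewrite /D trmxCD trmxCN EH DM; have /hermsymmxP -> := (psdmx_gram (Q *m L)).1.
have TD : T^t* *m D = 0.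
  rewrite mulmxBr DE !mulmxA -!trmxC_mul -{1}QH -trmxC_mul QG.
  by rewrite subrr.
have [Y []] := ortho_projector B; move BY: (B *m Y) => P PH PB.
have PD : P *m D = D.
  (* [1%:M - P] annihilates [B], so it factors through [T^t*], which annihilates [D]. *)
  have [|Z DZ] := @left_null_basis_factor _ _ _ _ _ _ T (1%:M - P) hT.
    by rewrite trmxCD trmxCN PH trmxC1 mulmxBl PB mul1mx subrr.
  have : (1%:M - P) *m D = 0.
    have -> : 1%:M - P = Z^t* *m T^t*.
      by rewrite -trmxC_mul -DZ trmxCD trmxCN PH trmxC1.
    by rewrite -mulmxA TD mulmx0.
  by rewrite mulmxBl mul1mx => /subr0_eq.
have DP : D *m P = D by rewrite -{1}DH -PH -trmxC_mul PD.
have EK : E + B *m (Y *m D *m Y^t*) *m B^t* = L^t* *m Q *m L.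
  rewrite -[RHS](subrK E) -/D addrC; congr (_ + _).
  by rewrite -{2}DP -PH -{2}PD -BY trmxC_mul !mulmxA.
exists (Y *m D *m Y^t*); rewrite EK; split.
  by rewrite DM; apply: psdmx_gram.
move=> q w; split=> [|TEw].
  rewrite DM -mulmxA => h; have QLw : Q *m L *m w = 0.
    by apply: gram_eq0; rewrite trmxC_mul -mulmxA h mulmx0.
  have -> : T^t* *m E = (L *m T)^t* *m Q *m L.
    by rewrite -{1}QH -trmxC_mul QG trmxC_mul -mulmxA -DE.
  by rewrite -!mulmxA (mulmxA Q) QLw mulmx0.
have -> : L^t* *m Q *m L = L^t* *m X^t* *m (T^t* *m E).
  by rewrite DE -{1}QH -DQ !trmxC_mul !mulmxA.
by rewrite -mulmxA TEw mulmx0.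
Qed.

(** * The rank conditions as a separation property *)

Section RankConditions.
Variables (C : numClosedFieldType) (n m t1 t2 s : nat).
Variables (E A : 'M[C]_n) (B : 'M[C]_(n, m)).
Variables (TB : 'M[C]_(n, t1)) (TEB : 'M[C]_(n, t2)) (S : 'M[C]_(n, s)).
Hypothesis hTB : left_null_basis B TB.
Hypothesis hTEB : left_null_basis (row_mx E B) TEB.
Hypothesis hS : right_null_basis (TEB^t* *m A) S.

(** Here [u] is the conjugate transpose of a vector of [N0] when [E] is Hermitian up to which
    conjugation turns [u *m B = 0] into membership in the kernel of [B^t*]; the vectors [w] run over
    [W]. *)
Definition separating :=
  forall u : 'rV_n, u *m E = 0 -> u *m B = 0 ->
    (forall w : 'cV_n, TB^t* *m E *m w = 0 -> u *m A *m w = 0) -> u = 0.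

(** Rank-nullity for [E] acting on the left kernel of [B]: the vectors it kills there form the left
    kernel of [row_mx E B]. *)
Lemma rank_left_null_restriction :
  \rank (TB^t* *m E) = (\rank (row_mx E B) - \rank B)%N.
Proof.
have := mxrank_mul_ker (TB^t*) E.
have -> : (TB^t* :&: kermx E :=: kermx (row_mx E B))%MS.
  apply/eqmxP/andP; split; last first.
    have /eqP := mulmx_ker (row_mx E B).
    rewrite mul_mx_row row_mx_eq0 => /andP[kE kB].
    by rewrite sub_capmx (left_null_basis_kermx hTB) !sub_kermx kE kB.
  apply/sub_kermxP; rewrite mul_mx_row.
  have /sub_kermxP -> := capmxSr (TB^t*) (kermx E).
  have : (TB^t* :&: kermx E <= kermx B)%MS.
    by rewrite -(left_null_basis_kermx hTB) capmxSl.
  by move/sub_kermxP ->; rewrite row_mx0.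
rewrite (left_null_basis_kermx hTB) !mxrank_ker => h.
have le_EB : (\rank (row_mx E B) <= n)%N := rank_leq_row _.
have le_B : (\rank B <= \rank (row_mx E B))%N.
  have {1}-> : B = row_mx E B *m col_mx 0 1%:M.
    by rewrite mul_row_col mulmx0 mulmx1 add0r.
  exact: mxrankM_maxl.
apply/eqP; rewrite -(eqn_add2r (n - \rank (row_mx E B))) h.
by rewrite addnBAC // subnKC.
Qed.

(** The second condition says that [Z *m S] has the rank of [Z], so that the row space of [Z] meets
    the left kernel of [S], which is the row space of [TEB^t* *m A], only in zero. The first one
    excludes a nonzero [u] with [u *m A = 0]. *)
Lemma rank_conditions_separating :
  \rank (row_mx E (row_mx A B)) = n /\
  \rank (TB^t* *m E *m S) = (\rank (row_mx E B) - \rank B)%N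
  <-> separating.
Proof.
rewrite -rank_left_null_restriction; set Z := TB^t* *m E.
have hEB := left_null_basis_mul0 hTEB; have MS := right_null_basis_mul0 hS.
have kerEB (u : 'rV_n) : u *m E = 0 -> u *m B = 0 -> exists y, u = y *m TEB^t*.
  move=> uE uB; suff /submxP[y ->] : (u <= TEB^t*)%MS by exists y.
  rewrite (left_null_basis_kermx hTEB); apply/sub_kermxP.
  by rewrite mul_mx_row uE uB row_mx0.
have := mxrank_mul_ker Z S => rZS; split=> [[rk1 rk2] u uE uB uA|sep].
  have [y Du] := kerEB u uE uB.
  have uAm r (w : 'M_(n, r)) : Z *m w = 0 -> u *m A *m w = 0.
    move=> Zw; apply/matrixP => i j.
    have /matrixP/(_ i 0) : u *m A *m (w *m (delta_mx j 0 : 'cV_r)) = 0.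
      by apply: uA; rewrite mulmxA Zw mul0mx.
    by rewrite mulmxA -colE !mxE.
  (* Equality of ranks gives [Z = Z *m S *m X^T], so the columns of [1%:M - S *m X^T] lie in the
     kernel of [Z]. *)
  have /submxP[X ZX] : (Z^T <= (Z *m S)^T)%MS.
    have : ((Z *m S)^T <= Z^T)%MS by rewrite trmx_mul submxMl.
    by move/mxrank_leqif_eq => -[_]; rewrite !mxrank_tr rk2 eqxx => /esym/andP[].
  have uA0 : u *m A = 0.
    have : u *m A *m (1%:M - S *m X^T) = 0.
      apply: uAm; rewrite mulmxBr mulmx1 mulmxA.
      by rewrite -[in X in X - _](trmxK Z) ZX trmx_mul trmxK subrr.
    have uAS : u *m A *m S = 0 by rewrite Du -(mulmxA y) -mulmxA MS mulmx0.
    by rewrite mulmxBr mulmx1 mulmxA uAS mul0mx subr0.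
  have frX : row_free (row_mx E (row_mx A B)) by rewrite /row_free rk1.
  by apply/eqP; rewrite -(mulmx_free_eq0 u frX) !mul_mx_row uE uB uA0 !row_mx0.
split.
  apply/eqP/row_free_inj => u /eqP; rewrite !mul_mx_row !row_mx_eq0.
  move=> /and3P[/eqP uE /eqP uA /eqP uB].
  by apply: sep => // w _; rewrite uA mul0mx.
move/eqP: rZS; suff -> : (Z :&: kermx S)%MS = 0 by rewrite mxrank0 addn0 => /eqP.
apply/eqP; rewrite -submx0; apply/rV_subP => v; rewrite sub_capmx.
move=> /andP[/submxP[z Dv] /sub_kermxP vS]; rewrite submx0.
have /submxP[y Dy] : (v <= TEB^t* *m A)%MS.
  rewrite submxE; have [Y ->] := right_null_basis_factor hS (mulmx_coker _).
  by rewrite mulmxA vS mul0mx.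
suff y0 : y *m TEB^t* = 0 by rewrite Dy mulmxA y0 mul0mx.
move/eqP: hEB; rewrite mul_mx_row row_mx_eq0 => /andP[/eqP hE /eqP hB].
apply: sep; rewrite -?mulmxA ?hE ?hB ?mulmx0 // => w Zw.
by rewrite !mulmxA -(mulmxA y) -Dy Dv -mulmxA -/Z Zw mulmx0.
Qed.
End RankConditions.

(** * Construction of the feedback matrix *)

Lemma separating_feedback (C : numClosedFieldType) (n m t1 t2 : nat)
    (E J R : 'M[C]_n) (B : 'M_(n, m)) (TB : 'M_(n, t1)) (TEB : 'M_(n, t2)) :
    psdmx E -> psdmx R -> J = - J^t* ->
    left_null_basis B TB -> left_null_basis (row_mx E B) TEB ->
    separating E (J - R) B TB ->
  exists K : 'M_m, psdmx (E + B *m K *m B^t*) /\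
    forall x : 'cV_n, (E + B *m K *m B^t*) *m x = 0 ->
      (forall y : 'cV_n, (E + B *m K *m B^t*) *m y = 0 ->
         y^t* *m (J - R) *m x = 0) -> x = 0.
Proof.
move=> psE psR JH hTB hTEB sep; set A := J - R.
have /hermsymmxP EH := psE.1; have /hermsymmxP RH := psR.1.
have [K0 [psM0 kerM0]] := psdmx_extension psE hTB.
move: sep kerM0; set Z := TB^t* *m E => sep kerM0.
move DM0: (E + _ *m _ *m _) => M0 in psM0 kerM0.
(* The columns of [D] span [N0]; below, those of [X] span the radical [D0], those of [row_mx D G]
   span [V], and the column space of [W] is the kernel of [Z]. *)
move DD: TEB hTEB => D hD {DD TEB}.
have /eqP := left_null_basis_mul0 hD.
rewrite mul_mx_row row_mx_eq0 => /andP[/eqP DE /eqP DB].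
have ED : E *m D = 0 by apply: trmxC_eq0; rewrite trmxC_mul EH.
have BD : B^t* *m D = 0 by apply: trmxC_eq0; rewrite trmxC_mul trmxCK.
have [kY [Y hY]] := right_null_basis_exists (D^t* *m A *m D).
move DX: (D *m Y) => X.
have DAX : D^t* *m A *m X = 0 by rewrite -DX mulmxA (right_null_basis_mul0 hY).
have XAX : X^t* *m A *m X = 0.
  by rewrite -{1}DX trmxC_mul -!mulmxA (mulmxA _ A) DAX mulmx0.
(* the radical of the dissipative form on the span of D lies in the kernel of R *)
have RX : R *m X = 0.
  apply: psdmx_null => //.
  have : (X^t* *m A *m X)^t* = 0 by rewrite XAX trmxC0.
  rewrite !trmxC_mul trmxCK mulmxA /A trmxCD trmxCN RH => h.
  have : X^t* *m (J^t* - R) *m X + X^t* *m (J - R) *m X = 0 by rewrite h XAX addr0.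
  rewrite -mulmxDl -mulmxDr {2}JH addrACA subrr add0r -opprD mulmxN mulNmx.
  rewrite -mulr2n -scaler_nat -scalemxAr -scalemxAl => /eqP.
  by rewrite oppr_eq0 scaler_eq0 pnatr_eq0 /= => /eqP.
have AHX : A^t* *m X = - (A *m X).
  rewrite /A trmxCD trmxCN RH mulmxDl mulNmx RX mulmxBl RX !subr0.
  by rewrite [in RHS]JH mulNmx opprK.
have XA : X^t* *m A = - (A *m X)^t*.
  by rewrite -trmxCN -AHX trmxC_mul trmxCK.
have [kW [W hW]] := right_null_basis_exists Z.
have [XW []] := ortho_projector W; move DPi: (W *m XW) => Pi PiH PiW.
have ZPi : Z *m Pi = 0 by rewrite -DPi mulmxA (right_null_basis_mul0 hW) mul0mx.
have PiPi : Pi *m Pi = Pi by rewrite -[in X in _ *m X]DPi mulmxA PiW DPi.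
have PiZ (q : nat) (w : 'M_(n, q)) : Z *m w = 0 -> Pi *m w = w.
  by move=> /(right_null_basis_factor hW)[y ->]; rewrite mulmxA PiW.
move DG: (Pi *m (A *m X)) => G.
have ZG : Z *m G = 0 by rewrite -DG mulmxA ZPi mul0mx.
have GG : (A *m X)^t* *m G = G^t* *m G.
  by rewrite -DG (trmxC_mul Pi) PiH -!mulmxA (mulmxA Pi Pi) PiPi.
have GAX : G^t* *m A *m X = G^t* *m G.
  by rewrite -GG -mulmxA -DG (trmxC_mul Pi) PiH -mulmxA.
have XAG : X^t* *m A *m G = - (G^t* *m G) by rewrite XA mulNmx GG.
have XAD : X^t* *m A *m D = 0.
  by apply: trmxC_eq0; rewrite XA mulNmx trmxCN (trmxC_mul _ D) trmxCK mulmxA DAX oppr0.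
have ZD : Z *m D = 0 by rewrite -mulmxA ED mulmx0.
(* [Q] projects onto the image of [V] under [B^t*]. With [P] its complement, adding [B P B^t*] keeps
   of the kernel of [M0] just the [w] whose image [B^t* *m w] lies in that of [V]. *)
have [XV []] := ortho_projector (B^t* *m row_mx D G).
move DQ: (_ *m XV) => Q QH QV.
pose P := 1%:M - Q.
have PH : P^t* = P by rewrite trmxCD trmxCN QH trmxC1.
have QQ : Q *m Q = Q by rewrite -[in X in _ *m X]DQ mulmxA QV DQ.
have PP : P *m P = P by rewrite /P mulmxBr mulmx1 mulmxBl mul1mx QQ subrr subr0.
have DM : E + B *m (K0 + P) *m B^t* = M0 + (P *m B^t*)^t* *m (P *m B^t*).
  rewrite mulmxDr mulmxDl addrA DM0 trmxC_mul trmxCK PH -!mulmxA (mulmxA P) PP.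
  by [].
exists (K0 + P); rewrite DM; split; first exact: psdmxD (psdmx_gram _).
set M := _ + _.
have MV (q : nat) (w : 'M_(n, q)) : Z *m w = 0 -> P *m (B^t* *m w) = 0 -> M *m w = 0.
  move=> Zw Pw; rewrite mulmxDl (kerM0 q w).2 // add0r -!mulmxA Pw.
  by rewrite mulmx0.
have MD : M *m D = 0 by apply: MV; rewrite // BD mulmx0.
have MG : M *m G = 0.
  apply: MV => //; have /eqP : P *m (B^t* *m row_mx D G) = 0.
    by rewrite mulmxBl mul1mx QV subrr.
  by rewrite !mul_mx_row row_mx_eq0 => /andP[_ /eqP].
have kerM (w : 'cV_n) : M *m w = 0 -> exists a b, w = D *m a + G *m b.
  move=> Mw.
  have [M0w Pw] : M0 *m w = 0 /\ P *m B^t* *m w = 0.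
    have /eqP : (w^t* *m M *m w) 0 0 = 0 by rewrite -mulmxA Mw mulmx0 mxE.
    rewrite mulmxDr mulmxDl mxE paddr_eq0; last 2 first.
    - exact: psM0.2.
    - exact: (psdmx_gram _).2.
    move=> /andP[/eqP w1 /eqP w2]; split.
      by apply: psdmx_null => //; apply/matrixP => i j; rewrite !ord1 w1 mxE.
    apply: gram_eq0; rewrite trmxC_mul -mulmxA (mulmxA _ _ w) mulmxA.
    by apply/matrixP => i j; rewrite !ord1 !mulmxA in w2 *; rewrite w2 mxE.
  have Zw : Z *m w = 0 by apply/kerM0.
  have Bw : B^t* *m w = B^t* *m (row_mx D G *m (XV *m (B^t* *m w))).
    move: Pw; rewrite -mulmxA mulmxBl mul1mx => /subr0_eq Pw.
    by rewrite [LHS]Pw -{1}DQ !mulmxA.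
  move: (XV *m _) Bw => c Bw; rewrite -[c]vsubmxK mul_row_col in Bw.
  set v := D *m _ + _ in Bw.
  have Zv : Z *m v = 0 by rewrite mulmxDr !mulmxA ZD ZG !mul0mx addr0.
  have Bd : B^t* *m (w - v) = 0 by rewrite mulmxBr Bw subrr.
  have Zd : Z *m (w - v) = 0 by rewrite mulmxBr Zw Zv subrr.
  (* As [B^t*] kills [w - v], this vector is [TB *m g], and its [E]-form equals
     [g^t* *m Z *m (w - v) = 0]. Hence it lies in [N0]. *)
  have Ed : E *m (w - v) = 0.
    apply: psdmx_null => //.
    have [|g Dg] := @left_null_basis_factor _ _ _ _ _ _ _ (w - v) hTB; last first.
      by rewrite -mulmxA {1}Dg trmxC_mul -mulmxA (mulmxA _ E) -/Z Zd mulmx0.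
    by apply: trmxC_eq0; rewrite trmxC_mul trmxCK.
  have [|g Dg] := @left_null_basis_factor _ _ _ _ _ _ _ (w - v) hD.
    apply/eqP; rewrite mul_mx_row row_mx_eq0; apply/andP; split; apply/eqP.
      by apply: trmxC_eq0; rewrite trmxC_mul trmxCK EH.
    by apply: trmxC_eq0; rewrite trmxC_mul trmxCK.
  exists (g + usubmx c), (dsubmx c).
  by rewrite mulmxDr -Dg -addrA subrK.
move=> x Mx nondeg; have [a [b Dx]] := kerM x Mx.
(* Testing against [X *m b] isolates [- |G b|^2], since [X^t* *m A] annihilates [D]. *)
have Gb : G *m b = 0.
  apply: gram_eq0.
  have := nondeg (X *m b).
  rewrite -{1}DX !mulmxA MD !mul0mx Dx => /(_ erefl).
  have -> : (X *m b)^t* *m A *m (D *m a + G *m b) = - ((G *m b)^t* *m (G *m b)).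
    transitivity (b^t* *m (X^t* *m A *m D *m a + X^t* *m A *m G *m b)).
      by rewrite trmxC_mul -!mulmxA -!mulmxDr.
    by rewrite XAD XAG mul0mx add0r trmxC_mul mulNmx mulmxN !mulmxA.
  by rewrite mulmxA => /eqP; rewrite oppr_eq0 => /eqP.
move: Dx; rewrite Gb addr0 => Dx.
(* Now [x] lies in [N0]; testing against all of [N0] puts it in the radical, so [x = X *m c]. *)
have DAD : D^t* *m A *m D *m a = 0.
  apply: gram_eq0; rewrite -mulmxA -Dx.
  have := nondeg (D *m (D^t* *m A *m x)); rewrite (mulmxA M) MD mul0mx => /(_ erefl).
  by rewrite !trmxC_mul !mulmxA.
have [c Da] := right_null_basis_factor hY DAD.
rewrite {}Da mulmxA DX in Dx.
have Gc : G *m c = 0.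
  apply: gram_eq0.
  have := nondeg (G *m c); rewrite (mulmxA M) MG mul0mx => /(_ erefl).
  rewrite Dx !trmxC_mul => <-; rewrite -!mulmxA; congr (_ *m _).
  by rewrite !mulmxA GAX.
(* [G *m c = 0] says that [A *m x] is orthogonal to [W]; skewness on the radical turns this into
   [x^t* *m A *m w = 0] on [W]. *)
apply: trmxC_eq0; apply: sep => [||w Zw].
- by apply: trmxC_eq0; rewrite trmxC_mul trmxCK EH Dx -DX -!mulmxA (mulmxA E) ED mul0mx.
- by apply: trmxC_eq0; rewrite trmxC_mul trmxCK Dx -DX -!mulmxA (mulmxA _ D) BD mul0mx.
rewrite Dx trmxC_mul -(mulmxA _ _ A) XA -(PiZ _ w Zw).
rewrite mulmxN mulNmx mulmxA -(mulmxA (c^t*)).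
have -> : (A *m X)^t* *m Pi = G^t* by rewrite -DG (trmxC_mul Pi) PiH.
by rewrite -trmxC_mul Gc trmxC0 mul0mx oppr0.
Qed.

(** * Necessity and the equivalence *)

(** Multiplication by [TB^t*] removes the feedback term, so the kernel of the closed-loop matrix
    lies in [W], while a row vector annihilating [E] and [B] annihilates that matrix. *)
Lemma separating_of_feedback (C : numClosedFieldType) (n m t : nat)
    (E A : 'M[C]_n) (B : 'M_(n, m)) (K : 'M_m) (TB : 'M_(n, t)) (nu : nat) :
    left_null_basis B TB ->
    pair_index (E + B *m K *m B^t*) A nu -> (nu <= 1)%N ->
  separating E A B TB.
Proof.
move=> hTB hnu nu1 u uE uB uA.
apply: (index_le1_nondegenerate hnu nu1) => [|w Mw].
  by rewrite mulmxDr uE add0r !mulmxA uB !mul0mx.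
apply: uA; have := congr1 (mulmx (TB^t*)) Mw.
rewrite mulmx0 mulmxDl mulmxDr -!mulmxA (mulmxA _ B).
by rewrite (left_null_basis_mul0 hTB) mul0mx addr0 mulmxA.
Qed.

Theorem theorem12 (R : realType) (n m : nat)
    (E J Rd : 'M[R[i]]_n) (B : 'M[R[i]]_(n, m))
    (hE : psdmx E) (hR : psdmx Rd) (hJ : J = - J^t*) (hB : \rank B = m)
    (t1 t2 s : nat)
    (TB : 'M[R[i]]_(n, t1)) (hTB : left_null_basis B TB)
    (TEB : 'M[R[i]]_(n, t2)) (hTEB : left_null_basis (row_mx E B) TEB)
    (S : 'M[R[i]]_(n, s)) (hS : right_null_basis (TEB^t* *m (J - Rd)) S) :
  (exists K : 'M[R[i]]_m,
     [/\ regular_pair (E + B *m K *m B^t*) (J - Rd),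
         (exists nu : nat,
            pair_index (E + B *m K *m B^t*) (J - Rd) nu /\ (nu <= 1)%N)
       & psdmx (E + B *m K *m B^t*)])
  <->
  (\rank (row_mx E (row_mx (J - Rd) B)) = n /\
   \rank (TB^t* *m E *m S) = (\rank (row_mx E B) - \rank B)%N).
Proof.
rewrite (rank_conditions_separating hTB hTEB hS); split=> [[K [_ [nu [hnu nu1]] psM]]|sep].
  exact: separating_of_feedback hTB hnu nu1.
have [K [psM nondeg]] := separating_feedback hE hR hJ hTB hTEB sep.
have [reg idx] := nondegenerate_index_le1 psM.1 nondeg.
by exists K.
Qed.
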